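(* Let $R=N\oplus Q$ be a finite-dimensional complex solvable Leibniz algebra with nilradical $N$, where $Q$ is a vector subspace complementary to $N$, and suppose $\dim Q=\dim(N/N^2)=k$. Then $R$ admits a basis $\{e_1,e_2,\dots,e_n,x_1,x_2,\dots,x_k\}$, adapted to $N$ in the sense of the context, and there exist $b_1,\dots,b_k\in\{0,1\}$ and scalars $\gamma_{i,j}^t,\beta_{j,i}^{i_t}\in\mathbb{C}$ such that the table of multiplications of $R$ is (all products of basis elements not listed being zero) $$\begin{array}{ll} [e_i,e_j]=\sum\limits_{t=k+1}^{n}\gamma_{i,j}^te_t, & 1\le i,j\le n,\\ {[e_i,x_i]}=e_i, & 1\le i\le k,\\ {[x_i,e_i]}=(b_i-1)e_i, & 1\le i\le k,\\ {[e_i,x_j]}=\alpha_{i,j}e_i, & k+1\le i\le n,\ 1\le j\le k,\\ {[x_j,e_i]}=\sum\limits_{t=1}^{q}\beta_{j,i}^{i_t}e_{i_t}, & k+1\le i\le n,\ 1\le j\le k, \end{array}$$ where $\alpha_{i,j}$ is the number of occurrences of the generator basis element $e_j$ in the non-generator basis element $e_i$, and, for each $i$, $\{e_{i_1},\dots,e_{i_q}\}$ is the set of all non-generator basis elements having the same structure as $e_i$.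
   Context: All algebras and vector spaces are finite-dimensional over $\mathbb{C}$. A (right) Leibniz algebra is a vector space $L$ with a bilinear bracket satisfying $[[x,y],z]=[[x,z],y]+[x,[y,z]]$ for all $x,y,z\in L$. Put $L^1=L$, $L^{m+1}=[L^m,L]$ and $L^{[1]}=L$, $L^{[m+1]}=[L^{[m]},L^{[m]}]$; $L$ is nilpotent (resp. solvable) if $L^m=0$ (resp. $L^{[m]}=0$) for some $m$. The nilradical is the maximal nilpotent ideal. Adapted basis: $\{e_1,\dots,e_n\}$ is a basis of $N$; $e_1,\dots,e_k$ are generators of $N$ (their classes form a basis of $N/N^2$); each non-generator basis element $e_i$, $k+1\le i\le n$, lies in $N^2$ and is an iterated bracket $e_i=[[\cdots[[e_{i_1},e_{i_2}],e_{i_3}],\cdots],e_{i_m}]$, $m\ge 2$, of generators $e_{i_1},\dots,e_{i_m}\in\{e_1,\dots,e_k\}$; and $x_1,\dots,x_k$ span a complement of $N$ in $R$. The number $\alpha_{i,j}$ is the number of indices $l$ with $i_l=j$ in the word expressing $e_i$. Two non-generator basis elements $e_i,e_m$ have the same structure if each generator occurs the same number of times in both, i.e. $\alpha_{i,p}=\alpha_{m,p}$ for all $1\le p\le k$ (so $e_i$ has the same structure as itself, and $q$ depends on $i$). *)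

(* Defs.v *)
From HB Require Import structures.
From mathcomp Require Export all_boot all_order all_algebra reals complex.

Set Implicit Arguments.
Unset Strict Implicit.
Unset Printing Implicit Defensive.

Import Order.TTheory GRing.Theory Num.Theory.
Local Open Scope ring_scope.

Section Leibniz.
Variables (K : fieldType) (L : vectType K).
Implicit Types (br : {bilinear L -> L -> L}) (U V W N : {vspace L}).

Definition right_leibniz br :=
  forall x y z : L, br (br x y) z = br (br x z) y + br x (br y z).

(* The span of all [u, v] with u in U and v in V: by bilinearity the brackets
   of basis vectors suffice, see brvP. *)
Definition brv br U V : {vspace L} :=
  <<[seq br u v | u <- vbasis U, v <- vbasis V]>>%VS.

Lemma brvP br U V W :
  reflect (forall u v, u \in U -> v \in V -> br u v \in W)
          (brv br U V <= W)%VS.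
Proof.
apply: (iffP idP) => [sUVW u v Uu Vv | sUVW]; last first.
  by apply/span_subvP=> _ /allpairsP[[u v] /= [/vbasis_mem Uu /vbasis_mem Vv ->]];
    apply: sUVW.
apply: (subvP sUVW).
rewrite (coord_vbasis Uu) (coord_vbasis Vv) linear_sumlz rpred_sum // => i _.
rewrite linearZl_LR rpredZ // linear_sumr rpred_sum // => j _.
rewrite linearZr_LR rpredZ //.
by apply/memv_span/allpairsP; exists ((vbasis U)`_i, (vbasis V)`_j);
  rewrite /= !mem_nth ?size_tuple.
Qed.

(* Indexed from 0: [lower_central br U m] is U^(m+1) and
   [derived_series br U m] is U^[m+1]. *)
Definition lower_central br U m : {vspace L} := iter m (brv br ^~ U) U.
Definition derived_series br U m : {vspace L} := iter m (fun V => brv br V V) U.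

Definition nilpotentv br U := exists m, lower_central br U m = 0%VS.
Definition solvablev br U := exists m, derived_series br U m = 0%VS.

Definition idealv br U :=
  (brv br U fullv <= U)%VS /\ (brv br fullv U <= U)%VS.

Definition nilradical br N :=
  [/\ idealv br N, nilpotentv br N
    & forall U, idealv br U -> nilpotentv br U -> (U <= N)%VS].

Definition complementv U V :=
  (U + V = fullv)%VS /\ (U :&: V = 0)%VS.

(* dim (U / V), for V a subspace of U *)
Definition dim_quot U V : nat := \dim U - \dim V.

(* The classes of the g i form a basis of U / V. *)
Definition basis_mod U V k (g : 'I_k -> L) :=
  (forall i, g i \in U) /\
  forall u, u \in U ->
    exists! c : {ffun 'I_k -> K}, u - \sum_(i < k) c i *: g i \in V.

(* [[..[[a_1, a_2], a_3], ..], a_m] for s = [:: a_1; ...; a_m] *)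
Definition iterated_br br (s : seq L) : L :=
  if s is a :: s' then foldl br a s' else 0.

(* Number of occurrences of the generator e_j in the word of the i-th
   non-generator. *)
Definition occ k m (w : 'I_m -> seq 'I_k) (i : 'I_m) (j : 'I_k) : nat :=
  count_mem j (w i).

Definition same_structure k m (w : 'I_m -> seq 'I_k) (i t : 'I_m) : bool :=
  [forall p, occ w i p == occ w t p].

(* With n = k + m and indices starting at 0, the generators are the e`_i with
   i < k and the non-generators are the e`_(k + i) with i < m; w i is the word
   in the generators that expresses e`_(k + i). *)
Record adapted_basis br N k m (e : (k + m).-tuple L) (x : k.-tuple L)
    (w : 'I_m -> seq 'I_k) : Prop := {
  adapted_basisN : basis_of N e;
  adapted_basisR : basis_of fullv (e ++ x);
  adapted_compl : complementv N <<x>>%VS;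
  adapted_gens : basis_mod N (brv br N N) (fun i : 'I_k => e`_i);
  adapted_nongens : forall i : 'I_m,
    [/\ e`_(k + i) \in brv br N N, (2 <= size (w i))%N
      & e`_(k + i) = iterated_br br [seq e`_j | j : 'I_k <- w i]] }.

Record mult_table br k m (e : (k + m).-tuple L) (x : k.-tuple L)
    (w : 'I_m -> seq 'I_k) (b : 'I_k -> bool)
    (gamma : 'I_(k + m) -> 'I_(k + m) -> 'I_m -> K)
    (beta : 'I_k -> 'I_m -> 'I_m -> K) : Prop := {
  table_ee : forall i j : 'I_(k + m),
    br e`_i e`_j = \sum_(t < m) gamma i j t *: e`_(k + t);
  table_gen_x : forall i : 'I_k, br e`_i x`_i = e`_i;
  table_x_gen : forall i : 'I_k, br x`_i e`_i = ((b i)%:R - 1) *: e`_i;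
  table_nongen_x : forall (i : 'I_m) (j : 'I_k),
    br e`_(k + i) x`_j = (occ w i j)%:R *: e`_(k + i);
  table_x_nongen : forall (i : 'I_m) (j : 'I_k),
    br x`_j e`_(k + i) =
      \sum_(t < m | same_structure w i t) beta j i t *: e`_(k + t);
  table_gen_x0 : forall i j : 'I_k, i != j -> br e`_i x`_j = 0;
  table_x_gen0 : forall i j : 'I_k, i != j -> br x`_j e`_i = 0;
  table_xx0 : forall i j : 'I_k, br x`_i x`_j = 0 }.

End Leibniz.

(* Main.v *)
From HB Require Import structures.
Require Import Defs.
From mathcomp Require Import boolp.

Set Implicit Arguments.
Unset Strict Implicit.
Unset Printing Implicit Defensive.

Import Order.TTheory GRing.Theory Num.Theory.
Local Open Scope ring_scope.

(** Write N^j for the lower central series of the nilradical N, with N^1 = N, and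
    R_x for the right multiplication u |-> [u, x]. The Leibniz identity says that
    R_x is a derivation and that R_([x, y]) is the commutator of R_x and R_y up to
    order, so Lie's theorem applies to the right multiplications
    ([lie_eigenvector]): any two invariant subspaces A <= B are joined by a
    complete flag of invariant subspaces, on whose steps x acts by weights
    ([flag_exists]). The weights are linear in x and vanish on brackets.

    For a flag of the whole algebra, the common kernel of the weights is a
    nilpotent ideal, hence lies in N. So N contains all brackets and every x with
    R_x nilpotent ([nilradical_nil]).

    For a flag from N^2 to N there are k weights lambda_1, .., lambda_k. If all of
    them vanish at x, then R_x is nilpotent modulo N^2, hence on N because it is a
    derivation, hence on the whole algebra, and x lies in N. Thus the weights are
    linearly independent on the k-dimensional complement Q and take arbitrary
    values there.

    Take x with all lambda_i(x) = 1. Since R_x is a derivation, it acts on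
    N^j / N^(j+1) with the only eigenvalue j ([shift_lower_central]), so it is
    invertible on N. Its kernel H is then a complement of N; it is closed under
    the bracket, and [H, H] lies in the intersection of N and H, so H is abelian
    ([null_complement], [null_abelian]). Choose x_1, .., x_k in H dual to the
    weights. Their right multiplications commute, so they are simultaneously
    diagonal on N / N^2 with the independent weights ([flag_diagonalization]); the
    eigenvectors lift to N, because the sum of the x_j acts on N^2 with
    eigenvalues at least 2 ([fixed_vector_lift]). This gives e_1, .., e_k with
    [e_i, x_j] = delta_ij e_i ([diagonal_complement]).

    By nilpotency N^2 is spanned by left-normed words in the e_i
    ([square_words]), and a derivation acts on such a word with the number of
    occurrences of letters as eigenvalue ([word_br_weight]); a basis extracted
    from the words is therefore adapted and diagonal for the right
    multiplications. As [x_j, x_l] = 0, the left multiplication by x_j commutes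
    with every R_(x_l), so it preserves the joint weight spaces, which are spanned
    by basis elements of equal structure. The weight space of a generator e_i is
    a line; there [x_j, e_i] = d e_i, and expanding [x_j, [x_j, e_i]] by the
    Leibniz identity yields d (d + delta_ij) = 0, which leaves the values 0 and
    -1 for i = j and 0 otherwise ([left_eigenvalue]). *)

(** * Eigenvectors and flags relative to a subspace *)

Section RelativeEigenvector.
Variables (K : closedFieldType) (V : vectType K) (T : 'End(V)).
Implicit Types (p q : {poly K}) (A : {vspace V}).

Definition poly_act p (w : V) : V := \sum_(i < size p) p`_i *: iter i T w.

Lemma poly_actE n p w : (size p <= n)%N ->
  poly_act p w = \sum_(i < n) p`_i *: iter i T w.
Proof.
move=> le_pn; rewrite /poly_act (big_ord_widen n (fun i => p`_i *: iter i T w)) //.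
rewrite [RHS](bigID (fun i : 'I_n => (i < size p)%N)) /=.
rewrite [X in _ + X]big1 ?addr0 // => i; rewrite -leqNgt => le_pi.
by rewrite nth_default // scale0r.
Qed.

Lemma poly_act_mulXsubC p c w :
  poly_act (p * ('X - c%:P)) w = T (poly_act p w) - c *: poly_act p w.
Proof.
have lep := leqnSn (size p).
have leX : (size (p * ('X - c%:P))%R <= (size p).+1)%N.
  by apply: leq_trans (size_polyMleq _ _) _; rewrite size_XsubC addn2.
rewrite (poly_actE w leX).
rewrite (poly_actE w lep).
rewrite [LHS](_ : _ = \sum_(i < (size p).+1) (p * 'X)`_i *: iter i T w
    - c *: \sum_(i < (size p).+1) p`_i *: iter i T w); last first.
  rewrite scaler_sumr -sumrB; apply: eq_bigr => i _.
  by rewrite mulrBr coefB coefMC scalerBl scalerA [c * _]mulrC.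
rewrite -(poly_actE w lep); congr (_ - _).
rewrite big_ord_recl coefMX /= scale0r add0r linear_sum; apply: eq_bigr => i _.
by rewrite coefMX /= linearZ.
Qed.

Lemma poly_act_closed p (W : V -> Prop) w :
    (forall c u v, W u -> W v -> W (c *: u + v)) ->
  (forall v, W v -> W (T v)) -> W w -> W (poly_act p w).
Proof.
move=> Wlin WT Ww; have W0 : W 0 by rewrite -(addNr w) -scaleN1r; apply: Wlin.
rewrite /poly_act; elim/big_rec: _ => // i v _ Wv; apply: Wlin => //.
by elim: (i : nat) => //= n; apply: WT.
Qed.

Lemma exists_annihilator w : exists2 p, p != 0 & poly_act p w = 0.
Proof.
pose X := [tuple iter i T w | i < (dim V).+1].
have nfreeX : ~~ free X.
  apply/negP=> /eqP freeX; have := dimvS (subvf <<X>>%VS).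
  by rewrite freeX size_tuple dimvf ltnn.
apply: contrapT => nex; case/negP: nfreeX; apply/freeP => a.
pose p := \poly_(j < (dim V).+1) a (inord j).
have Ep (j : 'I_(dim V).+1) : p`_j = a j by rewrite coef_poly ltn_ord inord_val.
move=> a0; have [p0 j|pn0] := eqVneq p 0; first by rewrite -Ep p0 coef0.
case: nex; exists p => //; rewrite (poly_actE w (size_poly _ _)) -[RHS]a0.
by apply: eq_bigr => j _; rewrite Ep -tnth_nth tnth_mktuple.
Qed.

(** An eigenvector of T in W / A, without forming the quotient: strip linear
    factors off a polynomial p with p(T) w in A until the vector leaves A. The
    space W is a predicate because it will be cut out by infinitely many
    conditions. *)
Lemma relative_eigenvector A (W : V -> Prop) w :
    (forall c u v, W u -> W v -> W (c *: u + v)) ->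
    (forall v, W v -> W (T v)) -> W w -> w \notin A ->
  exists2 v, W v /\ v \notin A & exists c, T v - c *: v \in A.
Proof.
move=> Wlin WT Ww nAw; have [p] := exists_annihilator w.
move=> p0 pw; have {pw}: poly_act p w \in A by rewrite pw mem0v.
elim: {p}(size p) {-2}p (leqnn (size p)) p0 => [|n IHn] p le_pn p0 Apw.
  by move: le_pn; rewrite leqn0 size_poly_eq0 (negPf p0).
have [/closed_rootP[c /factor_theorem[q Dp]] | /negPn/eqP sp1] := boolP (size p != 1).
  have q0 : q != 0 by apply: contraNneq p0 => q0; rewrite Dp q0 mul0r.
  have le_qn : (size q <= n)%N.
    by move: le_pn; rewrite Dp size_Mmonic ?monicXsubC // size_XsubC addn2.
  have [Aqw|nAqw] := boolP (poly_act q w \in A); first exact: IHn q le_qn q0 Aqw.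
  exists (poly_act q w); first by split=> //; apply: poly_act_closed.
  by exists c; rewrite -poly_act_mulXsubC -Dp.
case/negP: nAw; move: Apw; rewrite /poly_act sp1 big_ord1 /= rpredZeq.
have := p0; rewrite -lead_coef_eq0 lead_coefE sp1 => /negPf-> //.
Qed.
End RelativeEigenvector.

Section Adjoin.
Variables (K : fieldType) (V : vectType K).
Implicit Types (A B : {vspace V}) (v : nat -> V).

(** The steps of a flag that starts at A and adds one vector of v at a time. *)
Fixpoint adjoin A v n : {vspace V} :=
  if n is n'.+1 then (adjoin A v n' + <[v n']>)%VS else A.

Lemma mem_adjoinS A v n u :
  reflect (exists2 u', u' \in adjoin A v n & exists c, u = u' + c *: v n)
          (u \in adjoin A v n.+1).
Proof.
apply: (iffP memv_addP) => [[u' Uu' [_ /vlineP[c ->] ->]]|[u' Uu' [c ->]]].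
  by exists u' => //; exists c.
by exists u' => //; exists (c *: v n) => //; rewrite rpredZ // memv_line.
Qed.

Lemma adjoin_sub A v m n : (m <= n)%N -> (adjoin A v m <= adjoin A v n)%VS.
Proof.
elim: n => [|n IHn]; first by rewrite leqn0 => /eqP->; apply: subvv.
rewrite leq_eqVlt => /orP[/eqP-> | /IHn]; first exact: subvv.
by move=> /subv_trans-> //; apply: addvSl.
Qed.

Lemma adjoin_base A v n : (A <= adjoin A v n)%VS.
Proof. exact: (adjoin_sub A v (leq0n n)). Qed.

Lemma mem_adjoin A v i n : (i < n)%N -> v i \in adjoin A v n.
Proof.
move=> /(adjoin_sub A v)/subvP; apply.
by apply/(subvP (addvSr _ _))/memv_line.
Qed.

Lemma eq_adjoin A v v' n :
  (forall i, (i < n)%N -> v i = v' i) -> adjoin A v n = adjoin A v' n.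
Proof. by elim: n => //= n IHn eqv; rewrite IHn ?eqv // => i /ltnW/eqv. Qed.

Lemma dim_adjoin A v n : (forall i, (i < n)%N -> v i \notin adjoin A v i) ->
  \dim (adjoin A v n) = (\dim A + n)%N.
Proof.
elim: n => [|n IHn] nv /=; first by rewrite addn0.
rewrite dimv_disjoint_sum ?IHn => [|i /ltnW/nv//|].
  rewrite dim_vline addnS -addn1; case: eqP => // v0.
  by have := nv n (ltnSn n); rewrite v0 mem0v.
apply/eqP; rewrite -subv0; apply/subvP=> u.
rewrite memv_cap memv0 => /andP[Uu /vlineP[c Du]]; move: Uu.
rewrite Du rpredZeq (negPf (nv n _)) // orbF => /eqP->.
by rewrite scale0r.
Qed.

End Adjoin.

(** Keeps track of the index set T, so that the basis elements extracted from a
    spanning family of words still come with their words. *)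
Lemma free_subseq_span (K : fieldType) (V : vectType K) (T : eqType)
    (g : T -> V) (s : seq T) :
  exists t, [/\ {subset t <= s}, free (map g t) & <<map g t>>%VS = <<map g s>>%VS].
Proof.
elim: s => [|a s [t [sub_ts free_t span_t]]]; first by exists [::]; rewrite nil_free.
have [ga|nga] := boolP (g a \in <<map g t>>%VS).
  exists t; split=> //; first by move=> b /sub_ts; rewrite inE orbC => ->.
  rewrite /= span_cons -span_t; apply/esym/addv_idPr.
  by rewrite -memvE.
exists (a :: t); split; last by rewrite /= !span_cons span_t.
  by move=> b; rewrite !inE => /orP[->|/sub_ts->]; rewrite ?orbT.
by rewrite /= free_cons nga.
Qed.

(** * Lie's theorem for right multiplications *)

Section RightLeibniz.
Variables (K : numClosedFieldType) (L : vectType K) (br : {bilinear L -> L -> L}).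
Hypothesis leib : right_leibniz br.
Implicit Types (A B S U V M N W : {vspace L}) (chi : nat -> L -> K).

Definition adr x : 'End(L) := linfun (applyr br x).

Lemma adrE x u : adr x u = br u x. Proof. by rewrite lfunE. Qed.

Lemma br_r x y z : br x (br y z) = br (br x y) z - br (br x z) y.
Proof. by rewrite leib addrAC subrr add0r. Qed.

Lemma brvS U U' V V' : (U <= U')%VS -> (V <= V')%VS -> (brv br U V <= brv br U' V')%VS.
Proof.
move=> /subvP sU /subvP sV; apply/brvP=> u v /sU Uu /sV Vv.
by have /brvP := subvv (brv br U' V'); apply.
Qed.

Lemma mem_brv U V u v : u \in U -> v \in V -> br u v \in brv br U V.
Proof. by have /brvP := subvv (brv br U V); apply. Qed.

(** The invariance lemma behind Lie's theorem: a weight of an ideal M on a common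
    eigenvector w vanishes on brackets of x with M. Let w_n be the images of w
    under powers of R_x. Modulo A and the w_i with i < n - 1,
      [w_n, z] = chi(z) w_n + n chi([x, z]) w_(n-1).
    If p is least such that w_p depends on the previous vectors, comparing the
    coefficients of w_(p-1) on both sides of the dependency gives
    p chi([x, z]) = 0. This replaces the usual trace of a commutator. *)
Lemma dynkin_vanishing A M x w (chi : L -> K) :
    (brv br A M <= A)%VS -> (forall a, a \in A -> br a x \in A) ->
    (forall z, z \in M -> br x z \in M) ->
    w \notin A -> (forall z, z \in M -> br w z - chi z *: w \in A) ->
  forall z, z \in M -> chi (br x z) = 0.
Proof.
move=> /brvP AM Ax Mx nAw wM.
pose wx n := iter n (br^~ x) w; pose U n := adjoin A wx n.
have Ux n u : u \in U n -> br u x \in U n.+1.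
  elim: n u => [|n IHn] u; first by move/Ax; apply: subvP (adjoin_base _ _ _) _.
  case/mem_adjoinS=> u' /IHn Uu' [c ->].
  rewrite linearDl linearZl_LR; apply/mem_adjoinS; exists (br u' x) => //.
  by exists c.
(* The displayed congruence. For n = 0 the predecessor is 0 as well, but the
   second summand has coefficient 0. *)
have wxM n z : z \in M -> exists2 u, u \in U n.-1 &
  br (wx n) z = chi z *: wx n + (n%:R * chi (br x z)) *: wx n.-1 + u.
  elim: n z => [|[|n] IHn] z Mz.
  - exists (br w z - chi z *: w); first exact: wM.
    by rewrite mul0r scale0r addr0 addrC subrK.
  - have [u' Uu' E'] := IHn _ (Mx z Mz); have [u Uu E] := IHn z Mz.
    exists (br u x + u'); first by rewrite rpredD // Ax.
    rewrite [LHS]leib E E' !mul0r !scale0r !addr0 mul1r linearDl linearZl_LR /=.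
    by rewrite addrACA addrA [_ + u']addrC.
  have [u' Uu' E'] := IHn _ (Mx z Mz); have [u Uu E] := IHn z Mz.
  exists (br u x + (n.+1%:R * chi (br x (br x z))) *: wx n + u').
    rewrite rpredD ?(subvP (adjoin_sub _ _ (leqnSn n)) u') // rpredD ?Ux //.
    by rewrite rpredZ // mem_adjoin.
  rewrite [LHS]leib E E' !linearDl !linearZl_LR /= [n.+2%:R]mulrSr mulrDl mul1r scalerDl.
  by rewrite -!addrA; congr (_ + (_ + _)); exact: addrCA.
have wxU n z : z \in M -> exists2 u, u \in U n & br (wx n) z = chi z *: wx n + u.
  move=> Mz; have [u Uu ->] := wxM n z Mz; rewrite -addrA.
  exists ((n%:R * chi (br x z)) *: wx n.-1 + u) => //.
  case: n Uu => [|n] Uu; first by rewrite mul0r scale0r add0r.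
  by rewrite rpredD ?rpredZ ?mem_adjoin ?(subvP (adjoin_sub _ _ (leqnSn n))).
have UM n u z : z \in M -> u \in U n -> br u z \in U n.
  move=> Mz; elim: n u => [|n IHn] u; first by move=> Au; apply: AM.
  case/mem_adjoinS=> u' /IHn Uu' [c ->]; rewrite linearDl linearZl_LR.
  have sU := subvP (adjoin_sub A wx (leqnSn n)).
  have [u2 Uu2 ->] := wxU n z Mz.
  by rewrite rpredD ?rpredZ ?rpredD ?rpredZ ?mem_adjoin ?sU.
have exU : exists n, wx n \in U n.
  apply: contrapT => nex.
  have := dimvS (subvf (U (dim L).+1)); rewrite dimvf dim_adjoin; last first.
    by move=> i _; apply/negP=> Ui; case: nex; exists i.
  by rewrite addnS ltnNge leq_addl.
move=> z Mz; case: (ex_minnP exU) => [[|p]] Up minp.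
  by rewrite (negPf nAw) in Up.
have nUp : wx p \notin U p by apply/negP=> /minp; rewrite ltnn.
have [u Uu [c Dp]] := mem_adjoinS _ _ _ _ Up.
have [u' Uu' E] := wxM p.+1 z Mz; have [u2 Uu2 E2] := wxU p z Mz.
have U1 : br (wx p.+1) z - chi z *: wx p.+1 \in U p.
  rewrite Dp linearDl linearZl_LR /= E2 !scalerDr opprD addrACA !scalerA.
  by rewrite [chi z * c]mulrC [_ + c *: u2]addrC addrK rpredD ?rpredB ?rpredZ ?UM.
have : (p.+1%:R * chi (br x z)) *: wx p \in U p.
  rewrite [X in X \in _](_ : _ = br (wx p.+1) z - chi z *: wx p.+1 - u').
    exact: rpredB.
  by rewrite E [RHS]addrAC addrK addrC addKr.
by rewrite rpredZeq (negPf nUp) orbF mulf_eq0 pnatr_eq0 => /eqP.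
Qed.

(** Lie's theorem goes by induction along such hyperplanes M: a subspace of S
    that contains [S, S] is an ideal of S. *)
Lemma hyperplane_over U S : (U <= S)%VS -> U != S ->
  exists M x, [/\ (U <= M)%VS, x \in S, (M + <[x]>)%VS = S & (\dim M < \dim S)%N].
Proof.
move=> sUS neUS.
have /subvPn[x Sx nUx]: ~~ (S <= U)%VS.
  by apply: contra neUS => sSU; rewrite eqEsubv sUS.
have sUxS : (U + <[x]> <= S)%VS by rewrite subv_add sUS -memvE.
exists (U + (S :\: (U + <[x]>)))%VS, x; split=> //; first exact: addvSl.
  apply: subv_anti; rewrite !subv_add sUS diffvSl -memvE Sx /=.
  rewrite -[X in (X <= _)%VS](addv_diff_cap S (U + <[x]>)%VS) (capv_idPr sUxS).
  by rewrite addvA [((S :\: _) + U)%VS]addvC subvv.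
have dUx := @dim_adjoin _ _ U (fun=> x) 1.
rewrite /= addn1 in dUx.
have := dimv_cap_compl S (U + <[x]>); rewrite (capv_idPr sUxS) dUx; last by case.
move=> <-; rewrite addSn ltnS; exact: (dimv_add_leqif _ _).1.
Qed.

Lemma derived_seriesS U V m : (U <= V)%VS ->
  (derived_series br U m <= derived_series br V m)%VS.
Proof. by move=> sUV; elim: m => //= m IHm; apply: brvS. Qed.

Lemma solvable_brv_proper S : solvablev br S -> S != 0%VS -> brv br S S != S.
Proof.
case=> m Sm0 S0; apply: contraNneq S0 => SS; rewrite -Sm0.
by elim: m {Sm0} => //= m /eqP<-; rewrite SS.
Qed.

(** Lie's theorem for the action on B / A, by induction on the dimension of S. A
    hyperplane M of S above [S, S] has an eigenvector by induction; its weight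
    space W in B / A is invariant under the remaining direction x by
    [dynkin_vanishing], and an eigenvector of x in W is one for S. *)
Lemma lie_eigenvector S A B :
    (brv br S S <= S)%VS -> solvablev br S ->
    (brv br A S <= A)%VS -> (brv br B S <= B)%VS -> (A <= B)%VS -> A != B ->
  exists2 v, v \in B /\ v \notin A &
    exists chi : L -> K, forall x, x \in S -> br v x - chi x *: v \in A.
Proof.
move=> SS solS AS BS sAB neAB.
have [n le_Sn] := ubnP (\dim S); elim: n => // n IHn in S le_Sn SS solS AS BS *.
have [S0|S0] := eqVneq S 0%VS.
  have /subvPn[v Bv nAv]: ~~ (B <= A)%VS by apply: contra neAB; rewrite eqEsubv sAB.
  exists v => //; exists (fun=> 0) => x; rewrite S0 memv0 => /eqP->.
  by rewrite linear0r scale0r subr0 mem0v.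
have [M [x [sSSM Sx defS ltMS]]] := hyperplane_over SS (solvable_brv_proper solS S0).
have sMS : (M <= S)%VS by rewrite -defS addvSl.
have [|||||w [Bw nAw] [chi chiP]] := IHn M.
- by rewrite -ltnS; apply: leq_trans le_Sn; rewrite ltnS.
- exact: subv_trans (brvS sMS sMS) sSSM.
- by case: solS => m Sm; exists m; apply/eqP; rewrite -subv0 -Sm derived_seriesS.
- exact: subv_trans (brvS (subvv A) sMS) AS.
- exact: subv_trans (brvS (subvv B) sMS) BS.
pose W u := u \in B /\ forall z, z \in M -> br u z - chi z *: u \in A.
have/brvP ASm := AS; have /brvP BSm := BS.
have Mx z : z \in M -> br x z \in M.
  by move=> /(subvP sMS) Sz; apply/(subvP sSSM)/mem_brv.
have [|u [Bu Wu]|||v [[Bv Wv] nAv] [c Ac]] := @relative_eigenvector _ _ (adr x) A W w.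
- move=> c u1 u2 [Bu1 Wu1] [Bu2 Wu2]; split=> [|z Mz]; first by rewrite rpredD ?rpredZ.
  rewrite linearDl linearZl_LR scalerDr opprD addrACA scalerA [chi z * c]mulrC -scalerA.
  by rewrite -scalerBr rpredD ?rpredZ ?Wu1 ?Wu2.
- rewrite adrE; split=> [|z Mz]; first exact: BSm.
  have Sz := subvP sMS z Mz.
  have [Au|nAu] := boolP (u \in A); first by rewrite rpredB ?rpredZ // !ASm.
  have chi0 : chi (br x z) = 0.
    apply: (dynkin_vanishing _ _ Mx nAu Wu) => //; last by move=> a Aa; apply: ASm.
    exact: subv_trans (brvS (subvv A) sMS) AS.
  have := Wu _ (Mx z Mz); rewrite chi0 scale0r subr0 => Aux.
  rewrite leib addrAC rpredD // -linearZl_LR -linearBl; exact/ASm/Sx/Wu.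
- by [].
- by [].
exists v => //.
have /choice[chi' chi'P] : forall s, exists c', s \in S -> br v s - c' *: v \in A.
  move=> s; have [Ss|nSs] := boolP (s \in S); last by exists 0.
  move: Ss; rewrite -defS => /memv_addP[z Mz [_ /vlineP[d ->] ->]].
  exists (chi z + d * c) => _; rewrite linearDr linearZr_LR scalerDl opprD addrACA.
  by rewrite -scalerA -scalerBr rpredD ?Wv ?rpredZ // -adrE.
by exists chi'.
Qed.

(** A complete flag of right-invariant subspaces from A to B, with chi i the
    weight on its i-th step. Linearity of the weights follows from v i lying
    outside the previous step, see [flag_weight_linear]. *)
Definition weight_flag A B d v chi :=
  adjoin A v d = B /\ forall i, (i < d)%N -> v i \notin adjoin A v i /\
    forall x, br (v i) x - chi i x *: v i \in adjoin A v i.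

Lemma adjoin_br A v n x :
  (forall a, a \in A -> br a x \in A) ->
  (forall i, (i < n)%N -> exists c, br (v i) x - c *: v i \in adjoin A v i) ->
  forall u, u \in adjoin A v n -> br u x \in adjoin A v n.
Proof.
move=> Ax; elim: n => [|n IHn] vx u; first exact: Ax.
case/mem_adjoinS=> u' Uu' [c ->]; rewrite linearDl linearZl_LR.
have [c' Uc'] := vx n (ltnSn n); have sU := subvP (adjoin_sub A v (leqnSn n)).
rewrite rpredD //; first by apply/sU/IHn => // i /ltnW/vx.
rewrite rpredZ // -(subrK (c' *: v n) (br _ _)).
by rewrite rpredD ?rpredZ ?mem_adjoin // sU.
Qed.

Lemma flag_exists A B : solvablev br fullv -> (A <= B)%VS ->
    (brv br A fullv <= A)%VS -> (brv br B fullv <= B)%VS ->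
  exists v chi, weight_flag A B (\dim B - \dim A) v chi.
Proof.
move=> solL sAB AL BL; have /brvP ALm := AL.
have prefix d : (d <= \dim B - \dim A)%N -> exists v chi, (adjoin A v d <= B)%VS /\
    forall i, (i < d)%N -> v i \notin adjoin A v i /\
    forall x, br (v i) x - chi i x *: v i \in adjoin A v i.
  elim: d => [|d IHd] le_d; first by exists (fun=> 0), (fun _ _ => 0).
  have [v [chi [sUB vP]]] := IHd (ltnW le_d).
  have dU : \dim (adjoin A v d) = (\dim A + d)%N by apply: dim_adjoin => i /vP[].
  have [||||||w [Bw nUw] [c cP]] := @lie_eigenvector fullv (adjoin A v d) B; rewrite ?subvf //.
  - apply/brvP=> u x Uu _; apply: adjoin_br Uu => // [a Aa | i /vP[_ ic]].
      by rewrite ALm ?memvf.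
    by exists (chi i x); apply: ic.
  - by apply/eqP=> defB; move: le_d; rewrite -defB dU addKn ltnn.
  pose v' i := if (i < d)%N then v i else w.
  have Uv' i : (i <= d)%N -> adjoin A v' i = adjoin A v i.
    by move=> le_id; apply: eq_adjoin => j /leq_trans/(_ le_id) lt_jd; rewrite /v' lt_jd.
  exists v', (fun i => if (i < d)%N then chi i else c); split.
    by rewrite /= Uv' // subv_add sUB -memvE /v' ltnn.
  move=> i; rewrite ltnS => le_id; rewrite Uv' // /v'.
  case: ltnP => [/vP // | le_di]; have -> : i = d by apply/eqP; rewrite eqn_leq le_id.
  by split=> // x; apply: cP; rewrite memvf.
have [v [chi [sUB vP]]] := prefix _ (leqnn _); exists v, chi; split=> //.
apply/eqP; rewrite eqEdim sUB dim_adjoin ?subnKC ?dimvS // => i /vP[] //.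
Qed.

Section Weights.
Variables (A B : {vspace L}) (d : nat) (v : nat -> L) (chi : nat -> L -> K).
Hypothesis vP : weight_flag A B d v chi.
Hypothesis AL : (brv br A fullv <= A)%VS.
Variable i : nat.
Hypothesis lt_id : (i < d)%N.

Let U := adjoin A v i.

Lemma flag_notin : v i \notin U. Proof. by case: vP => _ /(_ i lt_id)[]. Qed.

Lemma flag_eigen x : br (v i) x - chi i x *: v i \in U.
Proof. by case: vP => _ /(_ i lt_id)[]. Qed.

Lemma flag_br u x : u \in U -> br u x \in U.
Proof.
move=> Uu; apply: adjoin_br Uu => // [a Aa | j lt_ji].
  by have /brvP := AL; apply; rewrite ?memvf.
by exists (chi j x); case: vP => _ /(_ j (ltn_trans lt_ji lt_id))[].
Qed.

Lemma flag_mem : v i \in B.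
Proof. by case: vP => <- _; rewrite mem_adjoin. Qed.

Lemma flag_uniq c x : br (v i) x - c *: v i \in U -> c = chi i x.
Proof.
move=> Uc; have := rpredB (flag_eigen x) Uc.
rewrite opprB addrC addrA subrK -scalerBl rpredZeq (negPf flag_notin) orbF.
by rewrite subr_eq0 => /eqP.
Qed.

Lemma flag_weight_linear a x y : chi i (a *: x + y) = a * chi i x + chi i y.
Proof.
apply/esym/flag_uniq; rewrite linearDr linearZr_LR scalerDl opprD addrACA.
by rewrite -scalerA -scalerBr rpredD ?rpredZ ?flag_eigen.
Qed.

(** The weights are one-dimensional representations, on which R_([x, y]) is a
    commutator of scalars. *)
Lemma flag_weight_br x y : chi i (br x y) = 0.
Proof.
apply/esym/flag_uniq; rewrite scale0r subr0 br_r.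
have E z t : br (br (v i) z) t - (chi i z * chi i t) *: v i \in U.
  rewrite -[br _ t](subrK (br (chi i z *: v i) t)) -linearBl -addrA.
  by rewrite linearZl_LR -scalerA -scalerBr rpredD ?rpredZ ?flag_br ?flag_eigen.
have := rpredB (E x y) (E y x).
by rewrite [chi i y * _]mulrC opprB addrA subrK.
Qed.

Lemma flag_weight_nil m x : (forall u, u \in B -> iter m (br^~ x) u \in A) -> chi i x = 0.
Proof.
move=> /(_ _ flag_mem)/(subvP (adjoin_base A v i)) Um.
have E : iter m (br^~ x) (v i) - chi i x ^+ m *: v i \in U.
  elim: m {Um} => [|m IHm] /=; first by rewrite scale1r subrr mem0v.
  rewrite -(subrK (br (chi i x ^+ m *: v i) x) (br _ x)) -linearBl -addrA.
  by rewrite linearZl_LR exprSr -scalerA -scalerBr rpredD ?rpredZ ?flag_br ?flag_eigen.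
have := rpredB Um E; rewrite opprB addrC subrK rpredZeq (negPf flag_notin) orbF.
by rewrite expf_eq0 => /andP[_ /eqP].
Qed.

End Weights.

Lemma flag_nil A B d v chi M : weight_flag A B d v chi ->
    (brv br A fullv <= A)%VS ->
    (forall i x, (i < d)%N -> x \in M -> chi i x = 0) ->
  (iter d (brv br ^~ M) B <= A)%VS.
Proof.
move=> vP AL chi0; have [<- _] := vP.
suff nilp n V : (n <= d)%N -> (V <= adjoin A v n)%VS ->
    (iter n (brv br ^~ M) V <= A)%VS by exact: nilp (subvv _).
elim: n V => [|n IHn] V le_nd sVU //; rewrite iterSr; apply: IHn (ltnW le_nd) _.
apply/brvP=> u x /(subvP sVU)/mem_adjoinS[u' Uu' [c ->]] Mx.
have := flag_eigen vP le_nd x; rewrite chi0 // scale0r subr0 => Uvx.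
by rewrite linearDl linearZl_LR rpredD ?rpredZ // (flag_br vP).
Qed.

(** * The nilradical as the common kernel of weights *)

(** All the weights at once, as one linear map: its kernel is their common
    kernel, and its image tells which weight values can be prescribed. *)
Lemma flag_weights_lfun A B d v chi : weight_flag A B d v chi ->
    (brv br A fullv <= A)%VS ->
  exists f : 'Hom(L, 'rV[K]_d), (forall x, f x = \row_i chi i x)
    /\ (brv br fullv fullv <= lker f)%VS.
Proof.
move=> vP AL; pose w x : 'rV[K]_d := \row_i chi i x.
have w_lin : linear w.
  by move=> a x y; apply/rowP=> i; rewrite !mxE (flag_weight_linear vP).
pose wl : {linear L -> 'rV[K]_d} := HB.pack w (GRing.isLinear.Build _ _ _ _ w w_lin).
exists (linfun wl); split=> [x|]; first by rewrite lfunE.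
apply/brvP=> x y _ _; rewrite memv_ker lfunE; apply/eqP/rowP=> i.
by rewrite !mxE (flag_weight_br vP AL).
Qed.

Lemma iter_brvS M M' U U' n : (M <= M')%VS -> (U <= U')%VS ->
  (iter n (brv br ^~ M) U <= iter n (brv br ^~ M') U')%VS.
Proof. by move=> sM sU; elim: n => //= n IHn; apply: brvS. Qed.

(** For a flag of the whole algebra, let x be in the kernel of all weights. The
    span of x and all brackets is an ideal on which all weights vanish, so it
    moves the flag down step by step and is nilpotent, hence lies in N. *)
Lemma nilradical_nil N : solvablev br fullv -> nilradical br N ->
  (brv br fullv fullv <= N)%VS /\
  forall x m, (forall u, iter m (br^~ x) u = 0) -> x \in N.
Proof.
move=> solL [_ _ maxN]; have brv0l : (brv br 0 fullv <= 0)%VS.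
  by apply/brvP=> u y; rewrite !memv0 => /eqP-> _; rewrite linear0l.
have [v [chi vP]] := flag_exists solL (sub0v fullv) brv0l (subvf _).
have [f [fE sRRf]] := flag_weights_lfun vP brv0l.
have kerN x : x \in lker f -> (brv br fullv fullv + <[x]> <= N)%VS.
  move=> fx; pose U := (brv br fullv fullv + <[x]>)%VS.
  have sRRU : (brv br fullv fullv <= U)%VS := addvSl _ _.
  apply: maxN.
    split; apply: subv_trans sRRU; apply: brvS; exact: subvf.
  exists (\dim {:L} - \dim (0%VS : {vspace L}))%N; apply/eqP; rewrite -subv0.
  apply: subv_trans (iter_brvS _ (subvv _) (subvf _)) _.
  apply: (flag_nil vP brv0l) => i y lt_id.
  have /subvP/[apply] : (U <= lker f)%VS by rewrite subv_add sRRf -memvE.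
  by rewrite memv_ker fE => /eqP/rowP/(_ (Ordinal lt_id)); rewrite !mxE.
split=> [|x m nilx]; first by apply: subv_trans (kerN 0 (mem0v _)); apply: addvSl.
suff /kerN : x \in lker f by rewrite subv_add memvE => /andP[].
rewrite memv_ker fE; apply/eqP/rowP=> i; rewrite !mxE.
by apply: (flag_weight_nil vP brv0l (ltn_ord i) (m := m)) => u _; rewrite nilx mem0v.
Qed.

(** * Weights on the lower central series *)

Lemma brv_ind U V (P : L -> Prop) :
    (forall c u w, P u -> P w -> P (c *: u + w)) -> P 0 ->
    (forall u w, u \in U -> w \in V -> P (br u w)) ->
  forall w, w \in brv br U V -> P w.
Proof.
move=> Plin P0 Pbr w /(@coord_span _ _ _ (in_tuple _)) ->.
elim/big_rec: _ => // i u _ Pu; apply: Plin => //.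
have := mem_nth 0 (ltn_ord i); case/allpairsP=> -[a b] /= [/vbasis_mem Ua /vbasis_mem Vb ->].
exact: Pbr.
Qed.

Definition shift (c : K) x u := br u x - c *: u.

(** The derivation R_x minus the sum of two candidate eigenvalues; this makes
    eigenvalues add up under the bracket. *)
Lemma shift_br a b x u w :
  shift (a + b) x (br u w) = br (shift a x u) w + br u (shift b x w).
Proof.
rewrite /shift leib linearBl linearBr linearZl_LR linearZr_LR /= scalerDl opprD.
by rewrite addrACA.
Qed.

Lemma iter_shift_lin n c x a u w :
  iter n (shift c x) (a *: u + w) = a *: iter n (shift c x) u + iter n (shift c x) w.
Proof.
elim: n => //= n ->; rewrite /shift linearDl linearZl_LR /= scalerDr opprD addrACA.
by rewrite scalerBr scalerA mulrC -scalerA.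
Qed.

(** The iterated product rule expands the m-th power on [u, w] into binomial
    multiples of the brackets in the hypothesis. *)
Lemma iter_shift_br m a b x (W : {vspace L}) u w :
    (forall i, (i <= m)%N ->
       br (iter i (shift a x) u) (iter (m - i) (shift b x) w) \in W) ->
  iter m (shift (a + b) x) (br u w) \in W.
Proof.
elim: m u w => [|m IHm] u w Wi; first exact: (Wi 0).
rewrite iterSr shift_br -[br (shift _ _ _) _]scale1r iter_shift_lin scale1r.
rewrite rpredD //; apply: IHm => i le_im.
  by rewrite -iterSr; have := Wi i.+1 le_im; rewrite subSS.
by rewrite -iterSr -subSn //; apply/Wi/leqW.
Qed.

Section LowerCentral.
Variables (N : {vspace L}) (x : L).
Hypothesis idN : idealv br N.

Let LC := lower_central br N.

Lemma lower_central_br j u w : u \in LC j -> w \in N -> br u w \in LC j.+1.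
Proof. exact: mem_brv. Qed.

Lemma sub_lower_central i j : (i <= j)%N -> (LC j <= LC i)%VS.
Proof.
move=> le_ij; rewrite -(subnKC le_ij); elim: (j - i)%N => [|n IHn].
  by rewrite addn0 subvv.
rewrite addnS; apply: subv_trans IHn; elim: (i + n)%N => [|m IHm] /=; last exact: brvS.
by apply: subv_trans idN.1; apply: brvS; rewrite ?subvf.
Qed.

(** [N^(j+1), N^2] lies in N^(j+3), because bracketing with [y, z] amounts to
    bracketing twice on the right. *)
Lemma lower_central_brr j u w : u \in LC j -> w \in brv br N N -> br u w \in LC j.+2.
Proof.
move=> Uu; move: w; apply: brv_ind => [c w1 w2 W1 W2||w1 w2 N1 N2].
- by rewrite linearDr linearZr_LR rpredD ?rpredZ.
- by rewrite linear0r mem0v.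
by rewrite br_r rpredB // !lower_central_br.
Qed.

Lemma lower_central_stable j u : u \in LC j -> br u x \in LC j.
Proof.
elim: j u => [|j IHj] u.
  by move=> Nu; apply: (subvP idN.1); rewrite mem_brv ?memvf.
move: u; apply: brv_ind => [c w1 w2 W1 W2||w1 w2 N1 N2].
- by rewrite linearDl linearZl_LR rpredD ?rpredZ.
- by rewrite linear0l mem0v.
rewrite leib rpredD //; first by rewrite lower_central_br ?IHj.
by rewrite lower_central_br //; apply: (subvP idN.1); rewrite mem_brv ?memvf.
Qed.

Lemma iter_shift_stable j n c u : u \in LC j -> iter n (shift c x) u \in LC j.
Proof.
by move=> LCu; elim: n => //= n IHn; rewrite rpredB ?rpredZ ?lower_central_stable.
Qed.

(** If R_x has c as its only eigenvalue on N / N^2, then it has j c as its only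
    eigenvalue on N^j / N^(j+1): in the product rule for the power m + a, either
    the left factor is hit m times and drops from N^j to N^(j+1), or the right
    factor is hit a times and drops from N to N^2. *)
Lemma shift_lower_central c a :
    (forall u, u \in N -> iter a (shift c x) u \in brv br N N) ->
  forall j, exists m, forall u, u \in LC j ->
    iter m (shift (j.+1%:R * c) x) u \in LC j.+1.
Proof.
move=> Nc; elim=> [|j [m LCm]]; first by exists a => u; rewrite mul1r; apply: Nc.
exists (m + a)%N; apply: brv_ind => [d w1 w2 W1 W2||w1 w2 LC1 N2].
- by rewrite iter_shift_lin rpredD ?rpredZ.
- by apply: iter_shift_stable; rewrite mem0v.
rewrite [j.+2%:R]mulrSr mulrDl mul1r; apply: iter_shift_br => i le_i.
have [le_mi | lt_im] := leqP m i.
  rewrite lower_central_br ?(iter_shift_stable (j := 0)) //.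
  by rewrite -(subnK le_mi) iterD iter_shift_stable ?LCm.
rewrite lower_central_brr ?iter_shift_stable //.
have le_a : (a <= m + a - i)%N by rewrite addnC -addnBA ?leq_addr // ltnW.
by rewrite -(subnK le_a) iterD (iter_shift_stable (j := 1)) ?Nc.
Qed.

End LowerCentral.

Lemma flag_shift_nil A B d v chi c x : weight_flag A B d v chi ->
    (brv br A fullv <= A)%VS -> (forall i, (i < d)%N -> chi i x = c) ->
  forall u, u \in B -> iter d (shift c x) u \in A.
Proof.
move=> vP AL chic; have [<- _] := vP.
suff nilp n u : (n <= d)%N -> u \in adjoin A v n -> iter n (shift c x) u \in A.
  by move=> u; apply: nilp.
elim: n u => [|n IHn] u le_nd // /mem_adjoinS[u' Uu' [b ->]].
rewrite iterSr; apply: IHn (ltnW le_nd) _; rewrite /shift.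
have := flag_eigen vP le_nd x; rewrite chic // => Uvx.
rewrite linearDl linearZl_LR /= scalerDr opprD addrACA scalerA mulrC -scalerA -scalerBr.
by rewrite rpredD ?rpredZ // rpredB ?rpredZ // (flag_br vP AL le_nd).
Qed.

Section Shift.
Variables (N : {vspace L}) (x : L) (c : K) (a : nat).
Hypothesis idN : idealv br N.
Hypothesis nilN : nilpotentv br N.
Hypothesis Nc : forall u, u \in N -> iter a (shift c x) u \in brv br N N.

Let LC := lower_central br N.

(** An eigenvector in N^(j0+1) whose eigenvalue e differs from those of R_x on
    the later quotients is pushed down the lower central series to 0. *)
Lemma shift_eigen_eq0 j0 e u : (forall j, (j0 <= j)%N -> e != j.+1%:R * c) ->
  u \in LC j0 -> br u x = e *: u -> u = 0.
Proof.
move=> ne_e LCu ux; have [l LCl] := nilN.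
suff {l LCl} E n : u \in LC (j0 + n)%N.
  have := subvP (sub_lower_central idN (leq_addl j0 l)) _ (E l).
  by rewrite LCl memv0 => /eqP.
elim: n => [|n IHn]; first by rewrite addn0.
rewrite addnS; have [m LCm] := shift_lower_central idN Nc (j0 + n).
have := LCm _ IHn; set b := _ * c.
have -> : iter m (shift b x) u = (e - b) ^+ m *: u.
  elim: (m) => [|k IHk] /=; first by rewrite scale1r.
  by rewrite IHk /shift linearZl_LR /= ux !scalerA [b * _]mulrC -scalerBl -mulrBr -exprSr.
rewrite rpredZeq expf_eq0 subr_eq0 (negPf (ne_e _ _)) ?leq_addr //.
by rewrite andbF.
Qed.

(** For c = 0 each quotient N^j / N^(j+1) is killed by a power of R_x, and R_x
    sends the whole algebra into N. *)
Lemma shift0_nil : c = 0 -> (brv br fullv fullv <= N)%VS ->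
  exists m, forall u, iter m (br^~ x) u = 0.
Proof.
move=> c0 sRRN; have [l LCl] := nilN.
have iterE m u : iter m (shift 0 x) u = iter m (br^~ x) u.
  by apply: eq_iter => w; rewrite /shift scale0r subr0.
have [m nilm] : exists m, forall u, u \in N -> iter m (br^~ x) u \in LC l.
  elim: (l) => [|j [m IHm]]; first by exists 0%N.
  have [m' LCm'] := shift_lower_central idN Nc j.
  rewrite c0 mulr0 in LCm'; exists (m' + m)%N => u Nu; rewrite iterD -iterE.
  exact/LCm'/IHm.
exists m.+1 => u; apply/eqP; rewrite -memv0 -LCl iterSr; apply: nilm.
by apply: (subvP sRRN); rewrite mem_brv ?memvf.
Qed.

End Shift.

(** Here R_x has the eigenvalue j on N^j / N^(j+1) for every j > 0. *)
Section Graded.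
Variables (N : {vspace L}) (x : L) (a : nat).
Hypothesis idN : idealv br N.
Hypothesis nilN : nilpotentv br N.
Hypothesis N1 : forall u, u \in N -> iter a (shift 1 x) u \in brv br N N.

Lemma square_fixed_eq0 y : y \in brv br N N -> br y x = y -> y = 0.
Proof.
move=> N2y yx; apply: (shift_eigen_eq0 idN nilN N1 (j0 := 1) (e := 1)) => //.
  by case=> // j _; rewrite mulr1 -[1]/(1%:R) eqr_nat.
by rewrite scale1r.
Qed.

(** R_x is injective on N, as 0 is not among its eigenvalues there; since its
    image lies in N, its rank is dim N. *)
Lemma null_complement : (brv br fullv fullv <= N)%VS -> complementv N (lker (adr x)).
Proof.
move=> sRRN; have NH0 : (N :&: lker (adr x) = 0)%VS.
  apply/eqP; rewrite -subv0; apply/subvP=> u; rewrite memv_cap memv_ker adrE memv0.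
  case/andP=> Nu /eqP ux0; apply/eqP.
  apply: (shift_eigen_eq0 idN nilN N1 (j0 := 0) (e := 0)) => //.
    by move=> j _; rewrite mulr1 eq_sym pnatr_eq0.
  by rewrite ux0 scale0r.
split=> //; apply/eqP; rewrite eqEdim subvf dimv_disjoint_sum //.
rewrite -(limg_ker_dim (adr x) fullv) capfv addnC leq_add2r dimvS //.
apply/subvP=> _ /memv_imgP[u _ ->]; rewrite adrE.
by apply: (subvP sRRN); rewrite mem_brv ?memvf.
Qed.

Lemma null_abelian g h : (brv br fullv fullv <= N)%VS ->
  g \in lker (adr x) -> h \in lker (adr x) -> br g h = 0.
Proof.
move=> sRRN Hg Hh; apply/eqP; rewrite -memv0 -(null_complement sRRN).2 memv_cap.
move: Hg Hh; rewrite (subvP sRRN) ?mem_brv ?memvf // !memv_ker !adrE => /eqP gx /eqP hx.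
by rewrite leib gx hx linear0l linear0r addr0 eqxx.
Qed.

End Graded.

(** The operator of h i is the identity on step i of the flag up to lower
    vectors, and it annihilates those modulo A: hence [v i, h i] is a joint
    eigenvector modulo A. *)
Lemma flag_diagonalization A B k v chi (h : 'I_k -> L) : weight_flag A B k v chi ->
    (brv br A fullv <= A)%VS ->
    (forall y i j, br (br y (h i)) (h j) = br (br y (h j)) (h i)) ->
    (forall i j : 'I_k, chi i (h j) = (i == j)%:R) ->
  exists u : 'I_k -> L, forall i : 'I_k, v i - u i \in adjoin A v i /\
    forall j, br (u i) (h j) - (i == j)%:R *: u i \in A.
Proof.
move=> vP AL comm chih.
(* By induction on n, the operator of h l kills the first n vectors modulo A
   when n <= l. Passing to v n with n < l: D_l v_n is a lower vector, so D_n D_l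
   v_n is 0, whereas D_l D_n v_n is D_l v_n up to D_l of a lower vector. *)
have kill n a (l : 'I_k) : (n <= l)%N -> a \in adjoin A v n -> br a (h l) \in A.
  elim: n a l => [|n IHn] a l le_nl.
    by move=> Aa; have /brvP := AL; apply; rewrite ?memvf.
  case/mem_adjoinS=> a' Ua' [c ->]; rewrite linearDl linearZl_LR.
  rewrite rpredD ?rpredZ //; first by rewrite (IHn a' l (ltnW le_nl)).
  have lt_nk : (n < k)%N := ltn_trans le_nl (ltn_ord l).
  pose n' := Ordinal lt_nk.
  have Un (j : 'I_k) := flag_eigen vP lt_nk (h j).
  have := Un l; rewrite (chih n' l) -val_eqE (ltn_eqF le_nl) scale0r subr0 => Ul.
  have := Un n'; rewrite (chih n' n') eqxx scale1r => Unn.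
  have := IHn _ l (ltnW le_nl) Unn; rewrite linearBl /= comm => Nl.
  by have := rpredB (IHn _ n' (leqnn n) Ul) Nl; rewrite opprB addrC subrK.
exists (fun i : 'I_k => br (v i) (h i)) => i.
have uE : v i - br (v i) (h i) \in adjoin A v i.
  rewrite -opprB rpredN; have := flag_eigen vP (ltn_ord i) (h i).
  by rewrite chih eqxx scale1r.
split=> // j; have [<-|ne_ij] := eqVneq i j.
  by rewrite scale1r -linearBl -opprB linearNl rpredN (kill i).
rewrite scale0r subr0 comm (kill i) //.
have := flag_eigen vP (ltn_ord i) (h j).
by rewrite chih (negPf ne_ij) scale0r subr0.
Qed.

(** If 1 is not an eigenvalue of R_y on A, then R_y - 1 is bijective on A, and a
    vector fixed modulo A can be corrected to a fixed vector. *)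
Lemma fixed_vector_lift A y u : (forall w, w \in A -> br w y \in A) ->
    (forall w, w \in A -> br w y = w -> w = 0) -> br u y - u \in A ->
  exists2 n, n \in A & br (u - n) y = u - n.
Proof.
move=> Ay injA Au; pose T := adr y - \1%VF.
have TE w : T w = br w y - w by rewrite add_lfunE opp_lfunE id_lfunE adrE.
have TA : (T @: A)%VS = A.
  apply/eqP; rewrite eqEdim limg_dim_eq ?leqnn ?andbT.
    by apply/subvP=> _ /memv_imgP[w Aw ->]; rewrite TE rpredB ?Ay.
  apply/eqP; rewrite -subv0; apply/subvP=> w; rewrite memv_cap memv_ker TE subr_eq0 memv0.
  by case/andP=> Aw /eqP/injA->.
move: Au; rewrite -TE -{1}TA => /memv_imgP[n An Tn]; exists n => //.
by apply/eqP; rewrite -subr_eq0 -TE linearB /= Tn subrr.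
Qed.

(** * Diagonal generators and an abelian complement *)

(** The linear map f collects the weights of a flag from N^2 to N; its kernel is
    exactly N, so it maps Q onto all weight values. *)
Lemma diagonal_complement N Q (k : nat) : solvablev br fullv -> nilradical br N ->
    complementv N Q -> \dim Q = k -> dim_quot N (brv br N N) = k ->
  exists e x : 'I_k -> L,
    [/\ forall i, e i \in N,
        (N <= brv br N N + <<[seq e i | i : 'I_k]>>)%VS,
        complementv N <<[seq x i | i : 'I_k]>>%VS,
        forall i j, br (e i) (x j) = (i == j)%:R *: e i
      & forall i j, br (x i) (x j) = 0].
Proof.
move=> solL nradN [NQ NQ0] dimQ dimN; have [idN nilN _] := nradN.
have [sRRN nilP] := nilradical_nil solL nradN.
set N2 := brv br N N in dimN *.
have sN2N : (N2 <= N)%VS := sub_lower_central idN (leq0n 1).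
have N2br u w : u \in N2 -> br u w \in N2 := @lower_central_stable N w idN 1 u.
have N2L : (brv br N2 fullv <= N2)%VS by apply/brvP=> u w N2u _; apply: N2br.
have [v [chi vP]] := flag_exists solL sN2N N2L idN.1.
rewrite [(_ - _)%N]dimN in vP.
have [f [fE sRRf]] := flag_weights_lfun vP N2L.
have fE' y (i : 'I_k) : chi i y = f y 0 i by rewrite fE mxE.
have sfN : (lker f <= N)%VS.
  apply/subvP=> y; rewrite memv_ker => /eqP fy0.
  have chi0 i : (i < k)%N -> chi i y = 0.
    by move=> lt_ik; rewrite (fE' y (Ordinal lt_ik)) fy0 mxE.
  have [m] := shift0_nil idN nilN (flag_shift_nil vP N2L chi0) erefl sRRN.
  exact: nilP.
have sNf : (N <= lker f)%VS.
  apply/subvP=> y Ny; rewrite memv_ker fE; apply/eqP/rowP=> i; rewrite !mxE.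
  apply/esym/(flag_uniq vP (ltn_ord i)); rewrite scale0r subr0.
  by apply: (subvP (adjoin_base _ _ _)); rewrite mem_brv // (flag_mem vP).
have fQ r : exists y, f y = r.
  have: r \in (f @: Q)%VS.
    suff -> : (f @: Q)%VS = fullv by rewrite memvf.
    have Qf0 : (Q :&: lker f = 0)%VS.
      by apply/eqP; rewrite -subv0 -NQ0 capvC capvS.
    by apply/eqP; rewrite eqEdim subvf dimvf dim_matrix mul1r limg_dim_eq // dimQ /=.
  by case/memv_imgP=> y _ ->; exists y.
have nil1 y : f y = const_mx 1 -> forall u, u \in N -> iter k (shift 1 y) u \in N2.
  move=> fy; apply: (flag_shift_nil vP N2L) => i lt_ik.
  by rewrite (fE' y (Ordinal lt_ik)) fy mxE.
have [x0 fx0] := fQ (const_mx 1).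
pose H := lker (adr x0).
have [NHf NH0] := null_complement idN nilN (nil1 _ fx0) sRRN.
have HH := null_abelian idN nilN (nil1 _ fx0) sRRN.
have /choice[h hP] : forall j : 'I_k, exists y, y \in H /\ f y = delta_mx 0 j.
  move=> j; have [y fy] := fQ (delta_mx 0 j).
  have : y \in (N + H)%VS by rewrite NHf memvf.
  case/memv_addP=> u Nu [y' Hy' Dy]; exists y'; split=> //.
  rewrite -fy Dy linearD /=; have := subvP sNf u Nu; rewrite memv_ker => /eqP->.
  by rewrite add0r.
have Hh j := (hP j).1; have {hP}fh j := (hP j).2.
have chih (i j : 'I_k) : chi i (h j) = (i == j)%:R.
  by rewrite fE' fh mxE eqxx.
have comm y g g' : g \in H -> g' \in H -> br (br y g) g' = br (br y g') g.
  by move=> Hg Hg'; rewrite leib (HH g g') // linear0r addr0.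
have [u uP] := flag_diagonalization vP N2L (fun y i j => comm y _ _ (Hh i) (Hh j)) chih.
have uh i j := (uP i).2 j; have {uP}uE i := (uP i).1.
(* h0 lies in H and has all weights 1. Lifting u i to a vector e i fixed by h0
   makes e i an eigenvector of every h j: the defect [e i, h j] - delta_ij e i
   lies in N^2 and is again fixed by h0, so it vanishes. *)
pose h0 := \sum_j h j.
have Hh0 : h0 \in H by apply: rpred_sum.
have fh0 : f h0 = const_mx 1.
  apply/rowP=> i; rewrite linear_sum summxE mxE (bigD1 i) //= fh mxE !eqxx.
  by rewrite big1 ?addr0 // => j ne_ji; rewrite fh mxE eqxx eq_sym (negPf ne_ji).
have inj2 := square_fixed_eq0 idN nilN (nil1 _ fh0).
have /choice[n nP] : forall i : 'I_k, exists n, n \in N2 /\ br (u i - n) h0 = u i - n.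
  move=> i; have: br (u i) h0 - u i \in N2.
    rewrite linear_sumr /= (bigD1 i) //= addrAC rpredD ?rpred_sum //.
      by have := uh i i; rewrite eqxx scale1r.
    by move=> j ne_ji; have := uh i j; rewrite eq_sym (negPf ne_ji) scale0r subr0.
  by case/(fixed_vector_lift (fun w Nw => N2br w h0 Nw) inj2) => n; exists n.
have uN (i : 'I_k) : u i \in N.
  have sUN : (adjoin N2 v i <= N)%VS.
    have [defN _] := vP; rewrite -[X in (_ <= X)%VS]defN.
    exact: adjoin_sub (ltnW (ltn_ord i)).
  rewrite -(subKr (v i) (u i)) rpredB ?(flag_mem vP) //.
  exact: subvP sUN _ (uE i).
pose e (i : 'I_k) := u i - n i.
have e0 (i : 'I_k) : br (e i) h0 = e i := (nP i).2.
exists e, h; split.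
- by move=> i; rewrite rpredB ?uN // (subvP sN2N _ (nP i).1).
- have [defN _] := vP; rewrite -defN.
  suff sUE m : (m <= k)%N -> (adjoin N2 v m <= N2 + <<[seq e i | i : 'I_k]>>)%VS.
    exact: sUE.
  elim: m => [|m IHm] le_mk; first exact: addvSl.
  rewrite /= subv_add IHm 1?ltnW // -memvE.
  pose i := Ordinal le_mk; rewrite -(subrK (u i) (v m)) rpredD //.
    exact: subvP (IHm (ltnW le_mk)) _ (uE i).
  rewrite -(subrK (n i) (u i)) addrC memv_add ?(nP i).1 // memv_span //.
  by rewrite (map_f e) ?mem_enum.
- have sxH : (<<[seq h i | i : 'I_k]>> <= H)%VS.
    by apply/span_subvP=> _ /mapP[i _ ->].
  split; last by apply/eqP; rewrite -subv0 -NH0 capvS.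
  apply: subv_anti; rewrite subvf; apply/subvP=> y _.
  rewrite -(subrK (\sum_i f y 0 i *: h i) y) memv_add //.
    apply: (subvP sfN); rewrite memv_ker linearB subr_eq0 /= linear_sum.
    apply/eqP/rowP=> i; rewrite summxE (bigD1 i) //= linearZ /= fh !mxE !eqxx mulr1.
    rewrite big1 ?addr0 // => j ne_ji.
    by rewrite linearZ /= fh !mxE eqxx eq_sym (negPf ne_ji) mulr0.
  by rewrite rpred_sum // => i _; rewrite rpredZ // memv_span // map_f ?mem_enum.
- move=> i j; apply/eqP; rewrite -subr_eq0; apply/eqP/inj2; last first.
    by rewrite linearBl linearZl_LR /= comm // e0.
  have -> : br (e i) (h j) - (i == j)%:R *: e i =
      br (u i) (h j) - (i == j)%:R *: u i - (br (n i) (h j) - (i == j)%:R *: n i).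
    by rewrite linearBl scalerBr [in LHS]opprD [LHS]addrACA [in RHS]opprD.
  by rewrite rpredB ?uh // rpredB ?N2br ?rpredZ ?(nP i).1.
by move=> i j; apply: HH.
Qed.

(** * Words in the generators *)

Lemma br_span X Y W : (forall a b, a \in X -> b \in Y -> br a b \in W) ->
  forall u w, u \in <<X>>%VS -> w \in <<Y>>%VS -> br u w \in W.
Proof.
move=> XYW u w /(@coord_span _ _ _ (in_tuple X))-> /(@coord_span _ _ _ (in_tuple Y))->.
rewrite linear_sumlz rpred_sum // => i _; rewrite linearZl_LR rpredZ // linear_sumr.
by rewrite rpred_sum // => j _; rewrite linearZr_LR rpredZ // XYW ?mem_nth.
Qed.

Section Words.
Variables (k : nat) (e x : 'I_k -> L).
Implicit Types s : seq 'I_k.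

Definition word_br s := iterated_br br [seq e j | j <- s].

Lemma word_br_rcons s i : s != [::] -> word_br (rcons s i) = br (word_br s) (e i).
Proof. by case: s => // j s _; rewrite /word_br map_rcons /= foldl_rcons. Qed.

(** A derivation that scales the letters scales a word by the sum over its
    letters. *)
Lemma word_br_weight : (forall i j, br (e i) (x j) = (i == j)%:R *: e i) ->
  forall s j, br (word_br s) (x j) = (count_mem j s)%:R *: word_br s.
Proof.
move=> ex s j; elim/last_ind: s => [|s i IHs]; first by rewrite scale0r linear0l.
have [-> | s0] := eqVneq s [::]; first by rewrite /= addn0; apply: ex.
rewrite word_br_rcons // leib IHs ex linearZl_LR linearZr_LR /= -scalerDl -natrD.
by rewrite -cats1 count_cat /= addn0.
Qed.

Lemma word_br_lower_central N s n : (forall i, e i \in N) -> size s = n.+1 ->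
  word_br s \in lower_central br N n.
Proof.
move=> Ne; elim: n s => [|n IHn]; first by case=> // i [] // _; apply: Ne.
move=> s; elim/last_ind: s => // s i _; rewrite size_rcons => -[sz_s].
by rewrite word_br_rcons -?size_eq0 ?sz_s // lower_central_br ?IHn ?Ne.
Qed.

Fixpoint words n : seq (seq 'I_k) :=
  if n is n'.+1 then [seq rcons s i | s <- words n', i <- enum 'I_k] else [:: [::]].

Lemma size_words n s : s \in words n -> size s = n.
Proof.
elim: n s => [|n IHn] s; first by rewrite inE => /eqP->.
by case/allpairsP=> -[s' i] /= [/IHn <- _ ->]; rewrite size_rcons.
Qed.

(** Multiply a word plus an element of the next term by a generator plus an
    element of N^2: only the longer word survives modulo the term after. *)
Lemma lower_central_words N n : idealv br N -> (forall i, e i \in N) ->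
    (N <= brv br N N + <<[seq e i | i : 'I_k]>>)%VS ->
  (lower_central br N n <=
     <<[seq word_br s | s <- words n.+1]>> + lower_central br N n.+1)%VS.
Proof.
move=> idN Ne sN; elim: n => [|n IHn].
  rewrite addvC; apply: subv_trans sN _; rewrite addvS ?subvv //.
  apply: sub_span => _ /mapP[i _ ->]; apply/mapP; exists [:: i] => //.
  by apply/allpairsP; exists ([::], i); rewrite /= mem_enum.
apply/brvP=> u w LCu Nw.
have [w1 N2w1 [w2 ew2 ->]] := memv_addP (subvP sN _ Nw).
have [u1 Wu1 [u2 LCu2 Du]] := memv_addP (subvP IHn _ LCu).
have Nw2 : w2 \in N.
  by apply: (subvP _ _ ew2); apply/span_subvP=> _ /mapP[i _ ->].
rewrite linearDr /= {2}Du linearDl addrCA memv_add //; last first.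
  by apply: rpredD; [apply: (lower_central_brr LCu) | apply: (lower_central_br LCu2)].
apply: br_span Wu1 ew2 => _ _ /mapP[s s_n ->] /mapP[i _ ->].
rewrite -word_br_rcons -?size_eq0 ?(size_words s_n) // memv_span // map_f //.
by apply/allpairsP; exists (s, i); rewrite mem_enum.
Qed.

Lemma square_words N : idealv br N -> nilpotentv br N -> (forall i, e i \in N) ->
    (N <= brv br N N + <<[seq e i | i : 'I_k]>>)%VS ->
  exists t : seq (seq 'I_k),
    [/\ forall s, s \in t -> (2 <= size s)%N, free (map word_br t)
              & <<map word_br t>>%VS = brv br N N].
Proof.
move=> idN [c LCc] Ne sN; pose W n := flatten [seq words j | j <- iota 2 n].
have W2 n s : s \in W n -> (2 <= size s)%N.
  by case/flatten_mapP=> j; rewrite mem_iota => /andP[le2j _] /size_words->.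
have sNW n : (brv br N N <= <<map word_br (W n)>> + lower_central br N n.+1)%VS.
  elim: n => [|n IHn]; first by rewrite addvSr.
  apply: subv_trans IHn _; have -> : W n.+1 = W n ++ words n.+2.
    by rewrite /W -[in LHS](addn1 n) iotaD map_cat flatten_cat /= cats0.
  by rewrite map_cat span_cat -addvA addvS ?subvv // lower_central_words.
have [t [sub_tW free_t span_t]] := free_subseq_span word_br (W c).
exists t; split=> //; first by move=> s /sub_tW/W2.
apply: subv_anti; apply/andP; split.
  apply/span_subvP=> _ /mapP[s /sub_tW/W2 le2s ->].
  apply: (subvP (sub_lower_central idN (_ : 1 <= (size s).-1)%N)).
    by rewrite -subn1 subn_gt0.
  by apply: word_br_lower_central => //; rewrite prednK // ltnW.
rewrite span_t; apply: subv_trans (sNW c) _; rewrite subv_add subvv.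
by apply: subv_trans (sub_lower_central idN (leqnSn c)) _; rewrite LCc sub0v.
Qed.

End Words.

(** * The multiplication table *)

Lemma coord_weight n (e : n.-tuple L) N x (a : 'I_n -> K) c y s : basis_of N e ->
    (forall i : 'I_n, br e`_i x = a i *: e`_i) -> y \in N -> br y x = c *: y ->
  coord e s y != 0 -> a s = c.
Proof.
move=> eN ex Ny yx cs; apply/eqP; rewrite -(inj_eq (mulfI cs)).
rewrite [_ * c]mulrC -linearZ -yx {2}(coord_basis eN Ny).
rewrite linear_sumlz; under eq_bigr do rewrite linearZl_LR ex scalerA.
by rewrite /= coord_sum_free // (basis_free eN).
Qed.

(** Expand [x, [x, e]] in two ways. *)
Lemma left_eigenvalue x e c d : br x x = 0 -> e != 0 ->
  br e x = c *: e -> br x e = d *: e -> d * (d + c) = 0.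
Proof.
move=> xx e0 ex xe; have := br_r x x e.
rewrite xe linearZr_LR linearZl_LR /= xe ex xx linear0l sub0r => /eqP.
rewrite -subr_eq0 opprK !scalerA -scalerDl -mulrDr scaler_eq0 (negPf e0) orbF.
by move/eqP.
Qed.

Lemma basis_mod_direct k (g : 'I_k -> L) U V : (forall i, g i \in U) ->
    (U <= V + <<[seq g i | i : 'I_k]>>)%VS -> free [seq g i | i : 'I_k] ->
  (<<[seq g i | i : 'I_k]>> :&: V = 0)%VS -> basis_mod U V g.
Proof.
move=> Ug sU free_g gV; split=> // u Uu.
have /memv_addP[u1 Vu1 [u2 gu2 Du]] := subvP sU u Uu.
pose E := [tuple g i | i < k].
exists [ffun i => coord E i u2]; split=> [|d Vd].
  rewrite Du {1}(coord_span (X := E) gu2) -addrA -sumrB big1 ?addr0 // => i _.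
  by rewrite ffunE -tnth_nth tnth_mktuple subrr.
apply/ffunP=> i; rewrite ffunE.
have: u2 - \sum_i d i *: g i = 0.
  apply/eqP; rewrite -memv0 -gV memv_cap rpredB ?rpred_sum //=.
    by have := rpredB Vd Vu1; rewrite Du addrAC [u1 + _]addrC addrK.
  by move=> l _; rewrite rpredZ // memv_span // map_f ?mem_enum.
move/eqP; rewrite subr_eq0 => /eqP->.
under eq_bigr do rewrite -(tnth_mktuple g) (tnth_nth 0).
by rewrite coord_sum_free.
Qed.

Lemma multiplication_table N Q (k : nat) : solvablev br fullv -> nilradical br N ->
    complementv N Q -> \dim Q = k -> dim_quot N (brv br N N) = k ->
  exists m (e : (k + m).-tuple L) (x : k.-tuple L) (w : 'I_m -> seq 'I_k),
    adapted_basis br N e x w /\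
    exists (b : 'I_k -> bool) (gamma : 'I_(k + m) -> 'I_(k + m) -> 'I_m -> K)
           (beta : 'I_k -> 'I_m -> 'I_m -> K), mult_table br e x w b gamma beta.
Proof.
move=> solL nradN NQ dimQ dimN; have [idN nilN _] := nradN.
have [e0 [x0 [Ne sN NX ex xx]]] := diagonal_complement solL nradN NQ dimQ dimN.
have [t [t2 free_t span_t]] := square_words idN nilN Ne sN.
set N2 := brv br N N in dimN sN span_t.
have sN2N : (N2 <= N)%VS := sub_lower_central idN (leq0n 1).
pose m := size t.
(* The generators are treated as one-letter words, so that every basis element
   has a word, and its letter counts are its weights. *)
pose wd := [seq [:: i] | i <- enum 'I_k] ++ t.
have sz_wd : size wd == (k + m)%N by rewrite size_cat size_map size_enum_ord.
pose word (s : 'I_(k + m)) : seq 'I_k := nth [::] wd s.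
have sz_e : size (map (word_br e0) wd) == (k + m)%N by rewrite size_map.
pose e : (k + m).-tuple L := Tuple sz_e.
pose x := [tuple x0 i | i < k].
pose w (i : 'I_m) : seq 'I_k := nth [::] t i.
have eE (s : 'I_(k + m)) : e`_s = word_br e0 (word s).
  by rewrite (nth_map [::]) // (eqP sz_wd).
have word_l (i : 'I_k) : word (lshift m i) = [:: i].
  rewrite /word nth_cat size_map size_enum_ord /= ltn_ord (nth_map i) ?size_enum_ord //.
  by rewrite nth_ord_enum.
have word_r (i : 'I_m) : word (rshift k i) = w i.
  by rewrite /word nth_cat size_map size_enum_ord /= ltnNge leq_addr addKn.
have e_l (i : 'I_k) : e`_i = e0 i by rewrite (eE (lshift m i)) word_l.
have e_r (i : 'I_m) : e`_(k + i) = word_br e0 (w i) by rewrite (eE (rshift k i)) word_r.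
have x_E (i : 'I_k) : x`_i = x0 i by rewrite -tnth_nth tnth_mktuple.
have dimN2 : \dim N2 = m by rewrite -span_t (eqP free_t) size_map.
have dimNE : \dim N = (k + m)%N by rewrite -dimN -dimN2 subnK // dimvS.
have span_e : <<e>>%VS = (<<[seq e0 i | i : 'I_k]>> + N2)%VS.
  by rewrite /= map_cat span_cat span_t -map_comp.
have eN : basis_of N e.
  by rewrite basisEdim span_e addvC sN size_tuple dimNE leqnn.
have exw (s : 'I_(k + m)) (j : 'I_k) : br e`_s x`_j = (count_mem j (word s))%:R *: e`_s.
  by rewrite eE x_E (word_br_weight ex).
have free_e := basis_free eN.
have [c N2e] : exists c : L -> 'I_m -> K,
    forall y, y \in N2 -> y = \sum_(i < m) c y i *: e`_(k + i).
  pose X : m.-tuple L := map_tuple (word_br e0) (in_tuple t).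
  exists (fun y i => coord X i y) => y; rewrite -span_t => Xy.
  rewrite {1}(coord_span (X := X) Xy); apply: eq_bigr => i _.
  by rewrite e_r (nth_map [::]).
have NgN2 : (<<[seq e0 i | i : 'I_k]>> :&: N2 = 0)%VS /\ free [seq e0 i | i : 'I_k].
  move: free_e; rewrite /= map_cat cat_free span_t -map_comp.
  by case/and3P=> free_g _ /directv_addP.
have xeN (j : 'I_k) (s : 'I_(k + m)) : br x`_j e`_s \in N.
  by apply: (subvP idN.2); rewrite mem_brv ?memvf // (basis_mem eN) // mem_nth ?size_tuple.
exists m, e, x, w; split.
  split=> //.
  - rewrite basisEdim span_cat (span_basis eN) NX.1 subvv size_cat !size_tuple /=.
    by rewrite -NQ.1 dimv_disjoint_sum ?NQ.2 // dimNE dimQ.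
  - have [gN g_unique] : basis_mod N N2 e0 := basis_mod_direct Ne sN NgN2.2 NgN2.1.
    split=> [i|u /g_unique]; first by rewrite e_l.
    suff eqP d : \sum_(i < k) d i *: e`_i = \sum_(i < k) d i *: e0 i.
      by case=> d [Nd uniq_d]; exists d; split=> [|d']; rewrite eqP //; apply: uniq_d.
    by apply: eq_bigr => i _; rewrite e_l.
  - move=> i; have t_wi : w i \in t by rewrite mem_nth.
    split; last 1 first.
    + by rewrite e_r; congr (iterated_br _ _); apply: eq_map => j; rewrite e_l.
    + by rewrite -/N2 -span_t e_r memv_span ?map_f.
    + exact: t2.
(* [x_j, e_s] has the same weights as e_s, so only basis elements with the same
   letter counts as e_s occur in it. *)
have xe_weight (j : 'I_k) (s s' : 'I_(k + m)) :
    coord e s' (br x`_j e`_s) != 0 -> forall l, count_mem l (word s') = count_mem l (word s).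
  move=> cs' l; apply/eqP; rewrite -(eqr_nat K); apply/eqP.
  pose a (i : 'I_(k + m)) : K := (count_mem l (word i))%:R.
  apply: (@coord_weight _ e N x`_l a _ _ _ eN _ (xeN j s) _ cs') => [i|]; first exact: exw.
  by rewrite leib exw x_E x_E xx linear0l add0r linearZr_LR.
have perm_word s s' : (forall l, count_mem l (word s') = count_mem l (word s)) ->
    perm_eq (word s') (word s).
  by move=> eq_ct; apply/allP=> l _; rewrite /= eq_ct.
have xe_sum (j : 'I_k) (s : 'I_(k + m)) := coord_basis eN (xeN j s).
(* A word with the same letter counts as a one-letter word is that word. *)
have xe_gen (j i : 'I_k) : exists d, br x`_j e`_i = d *: e`_i.
  exists (coord e (lshift m i) (br x`_j e`_i)).
  rewrite {1}(xe_sum j (lshift m i)) (bigD1 (lshift m i)) //= big1 ?addr0 // => s ne_si.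
  have [->|/xe_weight/perm_word] := eqVneq (coord e s (br x`_j e`_(lshift m i))) 0.
    by rewrite scale0r.
  case: (split_ordP s) ne_si => [l|l] -> ne_si; rewrite ?word_r !word_l.
    by move/perm_mem/(_ i); rewrite !inE eqxx => /eqP il; rewrite il eqxx in ne_si.
  move/perm_size/eqP; rewrite eqn_leq leqNgt => /andP[/negP[]].
  by apply: t2; rewrite mem_nth.
have xe_eigen (j i : 'I_k) d :
    br x`_j e`_i = d *: e`_i -> d * (d + (i == j)%:R) = 0.
  move=> xe; have e_i0 : e`_i != 0.
    apply: contraTneq free_e => e_i0; apply/negP=> /free_not0/(_ (mem_nth 0 _)).
    by move=> /(_ i); rewrite size_tuple ltn_addr // e_i0 eqxx => /(_ isT).
  apply: left_eigenvalue e_i0 _ xe; first by rewrite x_E.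
  by rewrite (exw (lshift m i)) word_l /= addn0.
(* By [xe_eigen] the scalar in [x_i, e_i] is 0, for b_i = 1, or -1, for
   b_i = 0. *)
exists (fun i => br x`_i e`_i == 0), (fun i j => c (br e`_i e`_j)),
       (fun j i t => coord e (rshift k t) (br x`_j e`_(rshift k i))).
split.
- move=> i j; apply/N2e/mem_brv.
    by rewrite (basis_mem eN) // mem_nth ?size_tuple.
  by rewrite (basis_mem eN) // mem_nth ?size_tuple.
- by move=> i; rewrite e_l x_E ex eqxx scale1r.
- move=> i; have [xe0|xe0] := eqVneq (br x`_i e`_i) 0; first by rewrite xe0 subrr scale0r.
  have [d xe] := xe_gen i i; move/xe_eigen/eqP: (xe); rewrite eqxx mulf_eq0 addr_eq0.
  case/orP=> /eqP Dd; last by rewrite xe Dd sub0r.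
  by rewrite xe Dd scale0r eqxx in xe0.
- by move=> i j; rewrite (exw (rshift k i)) word_r.
- move=> i j; rewrite {1}(xe_sum j (rshift k i)) big_split_ord /= big1 ?add0r => [|l _].
    rewrite [RHS]big_mkcond; apply: eq_bigr => s _; case: ifPn => // diff_is.
    have [->|/xe_weight eq_ct] := eqVneq (coord e (rshift k s) (br x`_j e`_(rshift k i))) 0.
      by rewrite scale0r.
    case/negP: diff_is; apply/forallP=> p; rewrite /occ -!word_r eq_sym.
    exact/eqP/eq_ct.
  have [->|/xe_weight/perm_word] := eqVneq (coord e (lshift m l) (br x`_j e`_(rshift k i))) 0.
    by rewrite scale0r.
  rewrite word_l word_r => /perm_size/esym sz_wi.
  by have := t2 (w i); rewrite mem_nth // sz_wi => /(_ isT).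
- by move=> i j ne_ij; rewrite e_l x_E ex (negPf ne_ij) scale0r.
- move=> i j ne_ij; have [d xe] := xe_gen j i; move/xe_eigen/eqP: (xe).
  by rewrite (negPf ne_ij) addr0 mulf_eq0 orbb => /eqP d0; rewrite xe d0 scale0r.
- by move=> i j; rewrite !x_E.
Qed.

End RightLeibniz.

Theorem theorem3p2 (Re : realType) (R : vectType Re[i])
    (br : {bilinear R -> R -> R}) (N Q : {vspace R}) (k : nat)
    (R_leibniz : right_leibniz br)
    (R_solvable : solvablev br fullv)
    (N_nilradical : nilradical br N)
    (Q_compl : complementv N Q)
    (dimQ : \dim Q = k)
    (dimNN2 : dim_quot N (brv br N N) = k) :
  exists (m : nat) (e : (k + m).-tuple R) (x : k.-tuple R)
         (w : 'I_m -> seq 'I_k),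
    adapted_basis br N e x w /\
    exists (b : 'I_k -> bool)
           (gamma : 'I_(k + m) -> 'I_(k + m) -> 'I_m -> Re[i])
           (beta : 'I_k -> 'I_m -> 'I_m -> Re[i]),
      mult_table br e x w b gamma beta.
Proof.
exact: (multiplication_table R_leibniz R_solvable N_nilradical Q_compl dimQ dimNN2).
Qed.
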